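(* Let $k$ be an algebraically closed field, let $n$ be a positive even integer, and let $(\mathcal C,\Sigma^n,\Theta)$ be an essentially small, $k$-linear, Hom-finite, Krull-Schmidt $(n+2)$-angulated category which has Auslander-Reiten $(n+2)$-angles. Let $\operatorname{ind}(\mathcal C)$ be the set of isomorphism classes of indecomposable objects of $\mathcal C$, and let $\pi\colon K_0(\mathcal C,0)\to K_0(\mathcal C)$ be the canonical epimorphism from the split Grothendieck group to the Grothendieck group. Suppose that: (1) for each $X\in\operatorname{ind}(\mathcal C)$ there exists a positive integer $m_X$ such that for every $U\in\operatorname{ind}(\mathcal C)$ with $\operatorname{Hom}_{\mathcal C}(U,X)\neq 0$ we have $$\dim_k\operatorname{Hom}_{\mathcal C}(U,\Sigma^{-m_Xn}X)\neq\dim_k\operatorname{Hom}_{\mathcal C}(U,X),$$ where $\Sigma^{-m_Xn}$ denotes the $m_X$-fold iterate of the inverse of $\Sigma^n$; (2) the subgroup $\operatorname{Ker}\pi$ of $K_0(\mathcal C,0)$ is generated by the elements $[A_\bullet]$, where $$A_\bullet:\ A_0\xrightarrow{\alpha_0}A_1\xrightarrow{\alpha_1}A_2\xrightarrow{\alpha_2}\cdots\xrightarrow{\alpha_{n-1}}A_n\xrightarrow{\alpha_n}A_{n+1}\xrightarrow{\alpha_{n+1}}\Sigma^nA_0$$ runs through all Auslander-Reiten $(n+2)$-angles in $\mathcal C$. Then $\mathcal C$ is locally finite; that is, for every $X\in\operatorname{ind}(\mathcal C)$ there are only finitely many $Y\in\operatorname{ind}(\mathcal C)$ with $\operatorname{Hom}_{\mathcal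 C}(X,Y)\neq0$ and only finitely many $Y\in\operatorname{ind}(\mathcal C)$ with $\operatorname{Hom}_{\mathcal C}(Y,X)\neq0$.
   Context: **$(n+2)$-angulated categories (Geiss-Keller-Oppermann).** Let $\mathcal C$ be an additive category with an automorphism $\Sigma^n\colon\mathcal C\to\mathcal C$, $n\ge1$. (The symbol $\Sigma^n$ is a single functor, called the $n$-suspension; for $j\in\mathbb Z$, $\Sigma^{jn}$ denotes $(\Sigma^n)^j$.) An $(n+2)$-$\Sigma^n$-sequence is a sequence of objects and morphisms $$A_0\xrightarrow{f_0}A_1\xrightarrow{f_1}\cdots\xrightarrow{f_n}A_{n+1}\xrightarrow{f_{n+1}}\Sigma^nA_0 .$$ Its left rotation is $A_1\xrightarrow{f_1}A_2\to\cdots\xrightarrow{f_n}A_{n+1}\xrightarrow{f_{n+1}}\Sigma^nA_0\xrightarrow{(-1)^n\Sigma^nf_0}\Sigma^nA_1$. A morphism from such a sequence $(A_i,f_i)$ to another one $(B_i,g_i)$ is a tuple $(\varphi_0,\dots,\varphi_{n+1})$ with $\varphi_i\colon A_i\to B_i$, $\varphi_{i+1}f_i=g_i\varphi_i$ for $0\le i\le n$, and $(\Sigma^n\varphi_0)f_{n+1}=g_{n+1}\varphi_{n+1}$; it is an isomorphism if all $\varphi_i$ are isomorphisms. An $(n+2)$-angulated category is a triple $(\mathcal C,\Sigma^n,\Theta)$ where $\mathcal C$ is an additive category, $\Sigma^n\colon\mathcal C\to\mathcal C$ is an automorphism of $\mathcal C$, and $\Theta$ is a class of $(n+2)$-$\Sigma^n$-sequences,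 called $(n+2)$-angles, such that: - (N1) (a) $\Theta$ is closed under isomorphisms, direct sums and direct summands; (b) for every object $A$, the sequence $A\xrightarrow{1_A}A\to0\to\cdots\to0\to\Sigma^nA$ is in $\Theta$; (c) every morphism $f_0\colon A_0\to A_1$ is the first morphism of some sequence in $\Theta$. - (N2) A sequence is in $\Theta$ if and only if its left rotation is in $\Theta$. - (N3) Given two sequences $(A_i,f_i)$, $(B_i,g_i)$ in $\Theta$ and $\varphi_0\colon A_0\to B_0$, $\varphi_1\colon A_1\to B_1$ with $\varphi_1f_0=g_0\varphi_0$, there exist $\varphi_2,\dots,\varphi_{n+1}$ making $(\varphi_0,\dots,\varphi_{n+1})$ a morphism of $(n+2)$-$\Sigma^n$-sequences. - (N4) In (N3), $\varphi_2,\dots,\varphi_{n+1}$ can be chosen so that the mapping cone $$A_1\oplus B_0\xrightarrow{\left(\begin{smallmatrix}-f_1&0\\ \varphi_1&g_0\end{smallmatrix}\right)}A_2\oplus B_1\xrightarrow{\left(\begin{smallmatrix}-f_2&0\\ \varphi_2&g_1\end{smallmatrix}\right)}\cdots\xrightarrow{\left(\begin{smallmatrix}-f_{n+1}&0\\ \varphi_{n+1}&g_n\end{smallmatrix}\right)}\Sigma^nA_0\oplus B_{n+1}\xrightarrow{\left(\begin{smallmatrix}-\Sigma^nf_0&0\\ \Sigma^n\varphi_0&g_{n+1}\end{smallmatrix}\right)}\Sigma^nA_1\oplus\Sigma^nB_0$$ is in $\Theta$. **Auslander-Reiten $(n+2)$-angles.** Let $\operatorname{rad}_{\mathcal C}$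 be the Jacobson radical of $\mathcal C$ (the ideal with $\operatorname{rad}_{\mathcal C}(A,A)$ equal to the Jacobson radical of $\operatorname{End}_{\mathcal C}(A)$ for every $A$). A morphism $A\to B$ is left almost split if it is not a section and every morphism $A\to C$ that is not a section factors through it; a morphism $B\to C$ is right almost split if it is not a retraction and every morphism $A\to C$ that is not a retraction factors through it. An $(n+2)$-angle $A_0\xrightarrow{\alpha_0}A_1\to\cdots\xrightarrow{\alpha_n}A_{n+1}\xrightarrow{\alpha_{n+1}}\Sigma^nA_0$ is an Auslander-Reiten $(n+2)$-angle if $\alpha_0$ is left almost split, $\alpha_n$ is right almost split and, when $n\ge2$, $\alpha_1,\dots,\alpha_{n-1}$ lie in $\operatorname{rad}_{\mathcal C}$. It starts at $A_0$ and ends at $A_{n+1}$. The category $\mathcal C$ has Auslander-Reiten $(n+2)$-angles if for every indecomposable object $X$ there exist an Auslander-Reiten $(n+2)$-angle starting at $X$ and one ending at $X$. **Grothendieck groups.** Let $\mathcal C$ be essentially small and let $F(\mathcal C)$ be the free abelian group on the set of isomorphism classes $\langle A\rangle$ of objects $A$ of $\mathcal C$. For an $(n+2)$-angle $A_\bullet\colon A_0\to A_1\to\cdots\to A_{n+1}\to\Sigma^nA_0$ put $$\chi(A_\bullet)=\langle A_0\rangle-\langle A_1\rangle+\langle A_2\rangle-\cdots+(-1)^{n+1}\langle A_{n+1}\rangle\in F(\mathcal C).$$ Let $R(\mathcal C)$ be the subgroup generated by all $\chi(A_\bullet)$ with $A_\bullet$ an $(n+2)$-angle, and $R'(\mathcal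 C)$ the subgroup generated by all $\chi(A_\bullet)$ with $A_\bullet$ a split $(n+2)$-angle, i.e. one whose last morphism $A_{n+1}\to\Sigma^nA_0$ is zero. The Grothendieck group is $K_0(\mathcal C)=F(\mathcal C)/R(\mathcal C)$, and the split Grothendieck group is $K_0(\mathcal C,0)=F(\mathcal C)/R'(\mathcal C)$. The map $\pi\colon K_0(\mathcal C,0)\to K_0(\mathcal C)$ is the canonical quotient map. For an $(n+2)$-angle $A_\bullet$, $[A_\bullet]$ denotes the class of $\chi(A_\bullet)$ in $K_0(\mathcal C,0)$. *)

(* Defs.v *)
From HB Require Import structures.
From mathcomp Require Import all_boot all_algebra generic_quotient.
From mathcomp Require Import boolp classical_sets functions cardinality.
From mathcomp Require Import freeg.

Set Implicit Arguments.
Unset Strict Implicit.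
Unset Printing Implicit Defensive.

Import GRing.Theory.
Local Open Scope ring_scope.
Local Open Scope quotient_scope.
Local Open Scope classical_set_scope.

(** ** Generated subgroups *)

Definition is_subgroup (G : zmodType) (H : set G) : Prop :=
  H 0 /\ forall x y, H x -> H y -> H (x - y).

Definition subgroup_gen (G : zmodType) (S : set G) : set G :=
  [set x | forall H : set G, is_subgroup H -> S `<=` H -> H x].

(* Boolean version of [subgroup_gen], as [Quotient.quot] requires. *)
Definition subgroup_genb (G : zmodType) (S : set G) : {pred G} :=
  fun x => `[< subgroup_gen S x >].

Fact subgroup_gen_is_subgroup (G : zmodType) (S : set G) :
  is_subgroup (subgroup_gen S).
Proof.
split=> [H [] //|x y Sx Sy H H_sub SH].
by apply: H_sub.2; [apply: Sx | apply: Sy].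
Qed.

Fact subgroup_genb_closed (G : zmodType) (S : set G) :
  zmod_closed (subgroup_genb S).
Proof.
have [S0 SB] := subgroup_gen_is_subgroup S.
by split=> [|x y /asboolP Sx /asboolP Sy]; apply/asboolP; [|apply: SB].
Qed.

HB.instance Definition _ (G : zmodType) (S : set G) :=
  GRing.isZmodClosed.Build G (subgroup_genb S) (subgroup_genb_closed S).

(** ** [k]-linear additive categories with finite-dimensional Hom spaces *)

(* Hom-finiteness is the [vectType] structure of the Hom spaces. *)
Record linCat (k : fieldType) := LinCat {
  obj :> Type;
  mhom : obj -> obj -> vectType k;
  idm : forall A, mhom A A;
  cmp : forall A B D, mhom B D -> mhom A B -> mhom A D;
  cmpA : forall A B D E (h : mhom D E) (g : mhom B D) (f : mhom A B),
    cmp h (cmp g f) = cmp (cmp h g) f;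
  cmp1m : forall A B (f : mhom A B), cmp (idm B) f = f;
  cmpm1 : forall A B (f : mhom A B), cmp f (idm A) = f;
  cmp_linearl : forall A B D (f : mhom A B),
    linear (fun g : mhom B D => cmp g f);
  cmp_linearr : forall A B D (g : mhom B D),
    linear (fun f : mhom A B => cmp g f);
  (* a zero object *)
  zob : obj;
  idm_zob : idm zob = 0;
  (* binary biproducts *)
  bip : obj -> obj -> obj;
  in1 : forall A B, mhom A (bip A B);
  in2 : forall A B, mhom B (bip A B);
  pr1 : forall A B, mhom (bip A B) A;
  pr2 : forall A B, mhom (bip A B) B;
  pr1_in1 : forall A B, cmp (pr1 A B) (in1 A B) = idm A;
  pr2_in2 : forall A B, cmp (pr2 A B) (in2 A B) = idm B;
  pr1_in2 : forall A B, cmp (pr1 A B) (in2 A B) = 0;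
  pr2_in1 : forall A B, cmp (pr2 A B) (in1 A B) = 0;
  bip_id : forall A B,
    cmp (in1 A B) (pr1 A B) + cmp (in2 A B) (pr2 A B) = idm (bip A B)
}.

Arguments mhom {k l} A B.
Arguments idm {k l} A.
Arguments cmp {k l A B D} g f.
Arguments zob {k l}.
Arguments bip {k l} A B.
Arguments in1 {k l A B}.
Arguments in2 {k l A B}.
Arguments pr1 {k l A B}.
Arguments pr2 {k l A B}.

Notation "g ∘ f" := (cmp g f) (at level 40, left associativity).
Notation "A ⊕ B" := (bip A B) (at level 50, left associativity).

Section Category.
Variables (k : fieldType) (C : linCat k).
Implicit Types A B D X Y Z W : C.

(* The matrix [(a, b; c, d)]. *)
Definition mat2 A B Z W (a : mhom A Z) (b : mhom B Z) (c : mhom A W)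
    (d : mhom B W) : mhom (A ⊕ B) (Z ⊕ W) :=
  in1 ∘ (a ∘ pr1 + b ∘ pr2) + in2 ∘ (c ∘ pr1 + d ∘ pr2).

Definition section A B (f : mhom A B) : Prop :=
  exists g : mhom B A, g ∘ f = idm A.

Definition retraction A B (f : mhom A B) : Prop :=
  exists g : mhom B A, f ∘ g = idm B.

Definition is_iso A B (f : mhom A B) : Prop :=
  exists g : mhom B A, g ∘ f = idm A /\ f ∘ g = idm B.

Definition isomorphic A B : Prop := exists f : mhom A B, is_iso f.

Definition indecomposable X : Prop :=
  ~ isomorphic X zob /\
  forall A B, isomorphic X (A ⊕ B) -> isomorphic A zob \/ isomorphic B zob.

(* [End(X)] is a local ring: it is nonzero and a sum of two non-invertible
   elements is non-invertible. *)
Definition local_end X : Prop :=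
  idm X <> 0 /\
  forall f g : mhom X X, ~ is_iso f -> ~ is_iso g -> ~ is_iso (f + g).

Definition krull_schmidt : Prop :=
  forall X, exists s : seq C,
    (forall i, (i < size s)%N -> local_end (nth zob s i)) /\
    isomorphic X (foldr bip zob s).

(** *** The Jacobson radical *)

Definition left_ideal X (I : set (mhom X X)) : Prop :=
  is_subgroup I /\ forall g f, I f -> I (g ∘ f).

Definition maximal_left_ideal X (I : set (mhom X X)) : Prop :=
  [/\ left_ideal I, ~ I (idm X) &
      forall J, left_ideal J -> I `<=` J -> J (idm X) \/ J = I].

Definition jacobson X : set (mhom X X) :=
  [set f | forall I, maximal_left_ideal I -> I f].

Definition is_ideal (I : forall A B, set (mhom A B)) : Prop :=
  (forall A B, is_subgroup (I A B)) /\
  (forall A B D (g : mhom B D) (f : mhom A B),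
     I A B f \/ I B D g -> I A D (g ∘ f)).

(* [in_rad f]: [f] lies in the (unique) ideal of [C] whose value at [(X, X)] is
   the Jacobson radical of [End(X)], for all [X]. *)
Definition in_rad A B (f : mhom A B) : Prop :=
  exists I : forall A B, set (mhom A B),
    [/\ is_ideal I, forall X, I X X = @jacobson X & I A B f].

Definition left_almost_split A B (f : mhom A B) : Prop :=
  ~ section f /\
  forall D (h : mhom A D), ~ section h -> exists g : mhom B D, h = g ∘ f.

Definition right_almost_split B D (f : mhom B D) : Prop :=
  ~ retraction f /\
  forall A (h : mhom A D), ~ retraction h -> exists g : mhom A B, h = f ∘ g.

(** *** Isomorphism classes *)

Definition iso_rel : rel {classic C} := fun A B => `[< isomorphic A B >].

Fact iso_rel_refl : reflexive iso_rel.
Proof. by move=> A; apply/asboolP; exists (idm A), (idm A); rewrite cmp1m. Qed.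

Fact iso_rel_sym : symmetric iso_rel.
Proof.
by move=> A B; apply/asboolP/asboolP => -[f [g [gf fg]]]; exists g, f.
Qed.

Fact iso_rel_trans : transitive iso_rel.
Proof.
move=> B A D /asboolP [f [f' [f'f ff']]] /asboolP [g [g' [g'g gg']]].
apply/asboolP; exists (g ∘ f), (f' ∘ g'); split.
  by rewrite cmpA -(cmpA f') g'g cmpm1 f'f.
by rewrite cmpA -(cmpA g) ff' cmpm1 gg'.
Qed.

Canonical iso_equiv := EquivRel iso_rel iso_rel_refl iso_rel_sym iso_rel_trans.
Canonical iso_encModRel := defaultEncModRel iso_rel.

Definition isoclass : choiceType := {eq_quot iso_rel}.
Definition cls X : isoclass := \pi_({eq_quot iso_rel}) (X : {classic C}).

Definition locally_finite : Prop :=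
  forall X, indecomposable X ->
    finite_set [set cls Y | Y in
      [set Y | indecomposable Y /\ exists f : mhom X Y, f <> 0]] /\
    finite_set [set cls Y | Y in
      [set Y | indecomposable Y /\ exists f : mhom Y X, f <> 0]].

(** *** Chains of composable morphisms *)

(* [chain m A Z] is the type of sequences of [m + 1] composable morphisms
   [A -> C_1 -> ... -> C_m -> Z].  For [m > 0] such a sequence is a triple
   consisting of [C_1], of the morphism [A -> C_1] and of the rest. *)
Fixpoint chain (m : nat) A Z : Type :=
  if m is m'.+1 then {B : C & (mhom A B * chain m' B Z)%type} else mhom A Z.

Definition chain_cons m A B Z (f : mhom A B) (c : chain m B Z) :
  chain m.+1 A Z := existT _ B (f, c).

Fixpoint chain_rcons m A Z Y : chain m A Z -> mhom Z Y -> chain m.+1 A Y :=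
  if m isn't m'.+1 then fun (f : mhom A Z) z => @chain_cons 0 _ _ _ f z
  else fun c z => chain_cons (projT2 c).1 (chain_rcons (projT2 c).2 z).

(* Composition of the last morphism of a chain with another one. *)
Fixpoint chain_post m A Z Y : chain m A Z -> mhom Z Y -> chain m A Y :=
  if m isn't m'.+1 then fun (f : mhom A Z) z => z ∘ f
  else fun c z => chain_cons (projT2 c).1 (chain_post (projT2 c).2 z).

Record arrow := Arrow { dom : C; cod : C; mor : mhom dom cod }.

(* The [i]-th morphism of a chain, [0 <= i <= m]. *)
Fixpoint arr m A Z : chain m A Z -> nat -> arrow :=
  if m isn't m'.+1 then fun (f : mhom A Z) _ => Arrow f
  else fun c i =>
    if i is i'.+1 then arr (projT2 c).2 i' else Arrow (projT2 c).1.

Fixpoint chain0 m A Z : chain m A Z :=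
  if m is m'.+1 then chain_cons (0 : mhom A zob) (chain0 m' zob Z)
  else (0 : mhom A Z).

Fixpoint chain_sum m A Z B W : chain m A Z -> chain m B W ->
    chain m (A ⊕ B) (Z ⊕ W) :=
  if m isn't m'.+1 then fun (f : mhom A Z) (g : mhom B W) => mat2 f 0 0 g
  else fun c d => chain_cons (mat2 (projT2 c).1 0 0 (projT2 d).1)
                             (chain_sum (projT2 c).2 (projT2 d).2).

(* Families of morphisms [C_i -> D_i], [1 <= i <= m], between the inner objects
   of two chains. *)
Fixpoint inner m A Z B W : chain m A Z -> chain m B W -> Type :=
  if m isn't m'.+1 then fun _ _ => unit
  else fun c d =>
    (mhom (projT1 c) (projT1 d) * inner (projT2 c).2 (projT2 d).2)%type.

(* [commutes p q z]: all the squares of the ladder with vertical morphisms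
   [p : A -> B], then [q], then [z : Z -> W], commute. *)
Fixpoint commutes m A Z B W :
    forall (c : chain m A Z) (d : chain m B W),
      mhom A B -> inner c d -> mhom Z W -> Prop :=
  if m isn't m'.+1 then
    fun (f : mhom A Z) (g : mhom B W) p _ z => z ∘ f = g ∘ p
  else fun c d p q z =>
    q.1 ∘ (projT2 c).1 = (projT2 d).1 ∘ p /\ commutes q.1 q.2 z.

Fixpoint inner_iso m A Z B W :
    forall (c : chain m A Z) (d : chain m B W), inner c d -> Prop :=
  if m isn't m'.+1 then fun _ _ _ => True
  else fun c d q => is_iso q.1 /\ inner_iso q.2.

(* For chains [c = (c_i : C_i -> C_i+1)] from [A] to [Z] and
   [d = (d_i : D_i -> D_i+1)] from [B] to [W], vertical morphisms [p, q, z] as in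
   [commutes], and [y : Z -> Y], [g : E -> B], the chain
     [A ⊕ E -> C_1 ⊕ B -> ... -> Z ⊕ D_m -> Y ⊕ W]
   whose morphisms are the matrices [(- c_i, 0; p_i, d_i-1)], with [d_-1 = g],
   and finally [(- y, 0; z, d_m)]. *)
Fixpoint chain_cone m A Z B W Y E :
    forall (c : chain m A Z) (d : chain m B W),
      mhom A B -> inner c d -> mhom Z W -> mhom Z Y -> mhom E B ->
      chain m.+1 (A ⊕ E) (Y ⊕ W) :=
  if m isn't m'.+1 then fun (f : mhom A Z) (f' : mhom B W) p _ z y g =>
    chain_cons (mat2 (- f) 0 p g) (mat2 (- y) 0 z f' : chain 0 _ _)
  else fun c d p q z y g =>
    chain_cons (mat2 (- (projT2 c).1) 0 p g)
               (chain_cone q.1 q.2 z y (projT2 d).1).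

End Category.

Arguments chain {k C} m A Z.

(** ** [(n+2)]-angulated categories *)

Record automorphism (k : fieldType) (C : linCat k) := Automorphism {
  aobj :> C -> C;
  aobjV : C -> C;
  aobjK : cancel aobj aobjV;
  aobjVK : cancel aobjV aobj;
  amor : forall A B : C, mhom A B -> mhom (aobj A) (aobj B);
  amor_bij : forall A B, bijective (@amor A B);
  amor_id : forall A, amor (idm A) = idm (aobj A);
  amor_cmp : forall (A B D : C) (g : mhom B D) (f : mhom A B),
    amor (g ∘ f) = amor g ∘ amor f;
  amorD : forall (A B : C) (f g : mhom A B), amor (f + g) = amor f + amor g
}.

Arguments amor {k C} a {A B} f.

Section Sequences.
Variables (k : fieldType) (n : nat) (C : linCat k) (S : automorphism C).

(* An [(n+2)]-[S]-sequence [A_0 -> A_1 -> ... -> A_n+1 -> S A_0], as a chain of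
   [n + 2] morphisms from [A_0] to [S A_0]. *)
Record nseq := NSeq { start : C; body : chain n.+1 start (S start) }.

Definition nobj (A : nseq) (i : nat) : C := dom (arr (body A) i).
Definition nmor (A : nseq) (i : nat) : mhom (nobj A i) (cod (arr (body A) i)) :=
  mor (arr (body A) i).

Definition obj1 (A : nseq) : C := projT1 (body A).
Definition mor0 (A : nseq) : mhom (start A) (obj1 A) := (projT2 (body A)).1.
Definition tail1 (A : nseq) : chain n (obj1 A) (S (start A)) :=
  (projT2 (body A)).2.

Definition rotate (A : nseq) : nseq :=
  @NSeq (obj1 A) (chain_rcons (tail1 A) ((-1) ^+ n *: amor S (mor0 A))).

Record nseq_map (A B : nseq) := NSeqMap {
  map0 : mhom (start A) (start B);
  maps : inner (body A) (body B)
}.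

Definition map1 A B (p : nseq_map A B) : mhom (obj1 A) (obj1 B) := (maps p).1.
Definition maps2 A B (p : nseq_map A B) : inner (tail1 A) (tail1 B) :=
  (maps p).2.

Definition is_morphism A B (p : nseq_map A B) : Prop :=
  commutes (map0 p) (maps p) (amor S (map0 p)).

Definition nseq_iso A B : Prop :=
  exists p : nseq_map A B,
    [/\ is_morphism p, is_iso (map0 p) & inner_iso (maps p)].

(* The canonical isomorphism. *)
Definition susp_bip (A B : C) : mhom (S A ⊕ S B) (S (A ⊕ B)) :=
  amor S in1 ∘ pr1 + amor S in2 ∘ pr2.

Definition nseq_sum (A B : nseq) : nseq :=
  @NSeq (start A ⊕ start B)
    (chain_post (chain_sum (body A) (body B)) (susp_bip _ _)).

Definition nseq_triv (A : C) : nseq :=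
  @NSeq A (chain_cons (idm A) (chain0 n A (S A))).

Definition cone A B (p : nseq_map A B) : nseq :=
  @NSeq (obj1 A ⊕ start B)
    (chain_post
      (chain_cone (map1 p) (maps2 p) (amor S (map0 p)) (amor S (mor0 A))
         (mor0 B))
      (susp_bip _ _)).

Record angulation (angle : set nseq) : Prop := Angulation {
  N1_iso : forall A B, nseq_iso A B -> angle A -> angle B;
  N1_sum : forall A B, angle A -> angle B -> angle (nseq_sum A B);
  N1_summand : forall A B, angle (nseq_sum A B) -> angle A /\ angle B;
  N1_triv : forall A, angle (nseq_triv A);
  N1_mor : forall (A0 A1 : C) (f0 : mhom A0 A1),
    exists c : chain n A1 (S A0), angle (@NSeq A0 (chain_cons f0 c));
  N2 : forall A, angle A <-> angle (rotate A);
  N3 : forall A B, angle A -> angle B ->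
    forall (p0 : mhom (start A) (start B)) (p1 : mhom (obj1 A) (obj1 B)),
      p1 ∘ mor0 A = mor0 B ∘ p0 ->
      exists p : nseq_map A B,
        [/\ is_morphism p, map0 p = p0 & map1 p = p1];
  N4 : forall A B, angle A -> angle B ->
    forall (p0 : mhom (start A) (start B)) (p1 : mhom (obj1 A) (obj1 B)),
      p1 ∘ mor0 A = mor0 B ∘ p0 ->
      exists p : nseq_map A B,
        [/\ is_morphism p, map0 p = p0, map1 p = p1 & angle (cone p)]
}.

End Sequences.

Record angCat (k : fieldType) (n : nat) := AngCat {
  ang_cat :> linCat k;
  susp : automorphism ang_cat;
  angle : set (nseq n susp);
  angleP : angulation angle
}.

Arguments susp {k n} C : rename.
Arguments angle {k n} C : rename.

Section Angulated.
Variables (k : fieldType) (n : nat) (C : angCat k n).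

Definition AR_angle (A : nseq n (susp C)) : Prop :=
  [/\ angle C A,
      left_almost_split (nmor A 0),
      right_almost_split (nmor A n) &
      forall i, (0 < i < n)%N -> in_rad (nmor A i)].

Definition has_AR_angles : Prop :=
  forall X : C, indecomposable X ->
    (exists A, AR_angle A /\ nobj A 0 = X) /\
    (exists A, AR_angle A /\ nobj A n.+1 = X).

Definition Fgrp : zmodType := {freeg (isoclass C)}.

Definition chi (A : nseq n (susp C)) : Fgrp :=
  \sum_(i < n.+2) << (-1) ^+ i *g cls (nobj A i) >>.

Definition split_angle (A : nseq n (susp C)) : Prop :=
  angle C A /\ nmor A n.+1 = 0.

(* The relations [R(C)] and [R'(C)], before passing to the subgroups they
   generate. *)
Definition rels : set Fgrp := [set chi A | A in angle C].
Definition split_rels : set Fgrp := [set chi A | A in split_angle].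

Definition K0 : zmodType := Quotient.quot (subgroup_genb rels).
Definition K0_split : zmodType := Quotient.quot (subgroup_genb split_rels).

Definition K0_class (x : Fgrp) : K0 :=
  \pi_(Quotient.quot (subgroup_genb rels)) x.
Definition K0_split_class (x : Fgrp) : K0_split :=
  \pi_(Quotient.quot (subgroup_genb split_rels)) x.

(* The canonical epimorphism; see [K0_piE]. *)
Definition K0_pi (x : K0_split) : K0 :=
  K0_class (repr (x : Quotient.quot (subgroup_genb split_rels))).

Fact K0_piE (x : Fgrp) : K0_pi (K0_split_class x) = K0_class x.
Proof.
apply/eqP; rewrite /K0_pi /K0_class /K0_split_class -Quotient.idealrBE.
have: repr (\pi_(Quotient.quot (subgroup_genb split_rels)) x) - x
    \in subgroup_genb split_rels by rewrite Quotient.idealrBE reprK.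
move=> /asboolP gen; apply/asboolP => H H_sub relsH; apply: (gen H H_sub).
by apply: subset_trans relsH; apply: image_subset => A [].
Qed.

End Angulated.

(* Main.v *)
(** For an indecomposable object [U], the function [X |-> dim Hom(U, X)] extends
    to a homomorphism on the free group of isomorphism classes.  By exactness of
    [Hom(U, -)] on angles it kills split angles, and it kills an
    Auslander-Reiten angle ending at [Z] unless [U] or [S U] is isomorphic to
    [Z]: any other morphism to [Z] factors through the right almost split one,
    hence dies in the last term.  As [n] is even, [<X> - <S^-m X>] is zero in
    the Grothendieck group, so by (2) it is a finite combination of
    Auslander-Reiten angles, and by (1) only finitely many [U] map nontrivially
    to [X].  For the successors of [X], let the Auslander-Reiten angle ending at
    [S X] start at [Z]; axiom (N3) turns a nonzero [X -> Y] into a nonzero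
    [Y -> Z], and [Z] has finitely many predecessors. *)
Require Import Defs.
From HB Require Import structures.
From mathcomp Require Import all_boot all_algebra generic_quotient.
From mathcomp Require Import boolp classical_sets functions cardinality.
From mathcomp Require Import freeg.

Set Implicit Arguments.
Unset Strict Implicit.
Unset Printing Implicit Defensive.

Import GRing.Theory.
Local Open Scope ring_scope.
Local Open Scope classical_set_scope.

(** * Linear categories: idempotents, indecomposables and almost split morphisms *)

Section LinearCategory.
Variables (k : fieldType) (C : linCat k).
Implicit Types A B D X Y Z W U : C.

HB.instance Definition _ A B D (g : mhom B D) :=
  GRing.isLinear.Build k (mhom A B) (mhom A D) *:%R (cmp g)
    (cmp_linearr (l := C) (A := A) g).

(** With the arguments swapped, precomposition by a fixed [f] becomes a function that can carry a
    linear structure. *)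
Definition cmpr A B D (f : mhom A B) (g : mhom B D) : mhom A D := g ∘ f.

HB.instance Definition _ A B D (f : mhom A B) :=
  GRing.isLinear.Build k (mhom B D) (mhom A D) *:%R (@cmpr A B D f)
    (cmp_linearl (l := C) (D := D) f).

Lemma cmpm0 A B D (g : mhom B D) : g ∘ (0 : mhom A B) = 0.
Proof. exact: linear0. Qed.

Lemma cmp0m A B D (f : mhom A B) : (0 : mhom B D) ∘ f = 0.
Proof. exact: (linear0 (@cmpr A B D f)). Qed.

Lemma cmpmDl A B D (g g' : mhom B D) (f : mhom A B) :
  (g + g') ∘ f = g ∘ f + g' ∘ f.
Proof. exact: (linearD (@cmpr A B D f)). Qed.

Lemma cmpZr A B D a (g : mhom B D) (f : mhom A B) : g ∘ (a *: f) = a *: (g ∘ f).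
Proof. exact: linearZ. Qed.

Lemma cmpZl A B D a (g : mhom B D) (f : mhom A B) : (a *: g) ∘ f = a *: (g ∘ f).
Proof. exact: (linearZ_LR (@cmpr A B D f)). Qed.

Lemma mhom_to_zob A (f : mhom A zob) : f = 0.
Proof. by rewrite -(cmp1m f) idm_zob cmp0m. Qed.

Lemma isomorphic_zobP A : isomorphic A zob <-> idm A = 0.
Proof.
split=> [[f [g [<- _]]]|A0]; first by rewrite (mhom_to_zob f) cmpm0.
by exists 0, 0; rewrite A0 idm_zob !cmpm0.
Qed.

Lemma is_iso_idm A : is_iso (idm A).
Proof. by exists (idm A); rewrite cmp1m. Qed.

Lemma isomorphic_refl A : isomorphic A A.
Proof. by exists (idm A); exact: is_iso_idm. Qed.

Lemma isomorphic_sym A B : isomorphic A B -> isomorphic B A.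
Proof. by case=> f [g [gf fg]]; exists g, f. Qed.

Lemma isomorphic_trans B A D :
  isomorphic A B -> isomorphic B D -> isomorphic A D.
Proof.
by move=> /asboolP AB /asboolP BD; apply/asboolP/(iso_rel_trans AB BD).
Qed.

Lemma isomorphic_bip0r A B : isomorphic B zob -> isomorphic (A ⊕ B) A.
Proof.
move=> /isomorphic_zobP B0; exists pr1, in1; rewrite pr1_in1; split=> //.
by rewrite -bip_id -[in2 in RHS]cmpm1 B0 cmpm0 cmp0m addr0.
Qed.

Lemma clsP A B : cls A = cls B <-> isomorphic A B.
Proof.
have clsE : (cls A == cls B) = iso_rel A B by exact: eqmodE.
by split=> [/eqP|/asboolP AB]; [rewrite clsE => /asboolP |
  apply/eqP; rewrite clsE].
Qed.

Lemma cls_repr (c : isoclass C) : cls (repr c : C) = c.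
Proof. exact: reprK. Qed.

(** For nonzero objects of a Krull-Schmidt category this amounts to indecomposability, in a form
    that passes easily along isomorphisms and [S]. *)
Definition trivial_idempotents X : Prop :=
  forall e : mhom X X, e ∘ e = e -> e = 0 \/ e = idm X.

(** One of [e] and [idm X - e] is invertible, as their sum is; since their product is zero, the
    other one vanishes. *)
Lemma local_end_idempotents X : local_end X -> trivial_idempotents X.
Proof.
move=> [_ loc] e ee.
have ne : e ∘ (idm X - e) = 0 by rewrite linearB /= cmpm1 ee subrr.
have [[g [ge eg]]|nie] := pselect (is_iso e).
  by right; rewrite -ge -[in RHS]ee cmpA ge cmp1m.
have [[g [ge eg]]|nie'] := pselect (is_iso (idm X - e)).
  by left; rewrite -(cmpm1 e) -eg cmpA ne cmp0m.
by case: (loc _ _ nie nie'); rewrite subrKC; exact: is_iso_idm.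
Qed.

Lemma isomorphic_idempotents X Y :
  isomorphic X Y -> trivial_idempotents Y -> trivial_idempotents X.
Proof.
move=> [f [g [gf fg]]] Yid e ee.
have: (f ∘ e ∘ g) ∘ (f ∘ e ∘ g) = f ∘ e ∘ g.
  by rewrite !cmpA -(cmpA (f ∘ e)) gf cmpm1 -(cmpA f) ee.
have eE : g ∘ (f ∘ e ∘ g) ∘ f = e by rewrite !cmpA gf cmp1m -cmpA gf cmpm1.
move=> /Yid[] h; [left|right]; rewrite -eE h.
  by rewrite cmpm0 cmp0m.
by rewrite cmpm1 gf.
Qed.

(** In the Krull-Schmidt decomposition the first summand is nonzero, so the rest is zero and [X] is
    isomorphic to an object with local endomorphism ring. *)
Lemma indecomposable_idempotents X :
  krull_schmidt C -> indecomposable X -> trivial_idempotents X.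
Proof.
move=> KS [nX0 Xdec]; have [[|Y s] [sloc Xs]] := KS X; first by [].
have Yloc : local_end Y by exact: (sloc 0%N).
have [/isomorphic_zobP Y0|s0] := Xdec _ _ Xs; first by case: Yloc.
apply: (isomorphic_idempotents _ (local_end_idempotents Yloc)).
exact: isomorphic_trans Xs (isomorphic_bip0r _ s0).
Qed.

(** The projection of [A ⊕ B] onto [A] is idempotent; if it is zero then [A] is zero, if it is the
    identity then [B] is. *)
Lemma idempotents_indecomposable X :
  ~ isomorphic X zob -> trivial_idempotents X -> indecomposable X.
Proof.
move=> nX0 Xid; split=> // A B XAB.
have := isomorphic_idempotents (isomorphic_sym XAB) Xid.
move=> /(_ (in1 ∘ pr1)); rewrite !cmpA -(cmpA in1) pr1_in1 cmpm1 => /(_ erefl).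
case=> e; [left|right]; apply/isomorphic_zobP.
  by rewrite -[idm A]cmpm1 -(pr1_in1 A B) cmpA -(cmpA pr1) e cmpm0 cmp0m.
by rewrite -(pr2_in2 A B) -(cmpm1 pr2) -e cmpA pr2_in1 !cmp0m.
Qed.

Lemma retraction_iso U Z (v : mhom U Z) :
  trivial_idempotents U -> ~ isomorphic Z zob -> retraction v -> isomorphic U Z.
Proof.
move=> Uid nZ0 [w vw]; have [] := Uid (w ∘ v).
- by rewrite !cmpA -(cmpA w) vw cmpm1.
- move=> wv; case: nZ0; apply/isomorphic_zobP.
  by rewrite -[idm Z]cmpm1 -vw cmpA -(cmpA v) wv cmpm0 cmp0m.
- by move=> wv; exists v, w.
Qed.

Lemma right_almost_split_target B Z (f : mhom B Z) :
  right_almost_split f -> ~ isomorphic Z zob.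
Proof.
move=> [nf _] /isomorphic_zobP Z0; apply: nf; exists 0.
by rewrite cmpm0 Z0.
Qed.

(** If [A] were a sum of two nonzero objects, neither projection would be a section; both would
    factor through [f], and recombining the factors would make [f] a section. *)
Lemma left_almost_split_indecomposable A B (f : mhom A B) :
  left_almost_split f -> indecomposable A.
Proof.
move=> [nf fP]; split=> [/isomorphic_zobP A0|X Y [u [v [vu uv]]]].
  by apply: nf; exists 0; rewrite A0 cmp0m.
have [|nX0] := pselect (isomorphic X zob); first by left.
have [|nY0] := pselect (isomorphic Y zob); first by right.
have npr1 : ~ section (pr1 ∘ u).
  case=> w wE; apply: nY0; apply/isomorphic_zobP.
  have h : w ∘ pr1 = v by rewrite -[RHS]cmp1m -wE -!cmpA uv cmpm1.
  by rewrite -(pr2_in2 X Y) -[pr2]cmpm1 -uv -h -!cmpA pr1_in2 !cmpm0.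
have npr2 : ~ section (pr2 ∘ u).
  case=> w wE; apply: nX0; apply/isomorphic_zobP.
  have h : w ∘ pr2 = v by rewrite -[RHS]cmp1m -wE -!cmpA uv cmpm1.
  by rewrite -(pr1_in1 X Y) -[pr1]cmpm1 -uv -h -!cmpA pr2_in1 !cmpm0.
have [g1 e1] := fP _ _ npr1; have [g2 e2] := fP _ _ npr2.
case: nf; exists (v ∘ (in1 ∘ g1 + in2 ∘ g2)).
by rewrite -cmpA cmpmDl -!cmpA -e1 -e2 !cmpA -cmpmDl bip_id cmp1m.
Qed.

Definition hdim U X : nat := \dim {: mhom U X}.

Lemma isomorphic_hdim U X Y : isomorphic X Y -> hdim U X = hdim U Y.
Proof.
have half (V W : C) : isomorphic V W -> (hdim U V <= hdim U W)%N.
  move=> [f [g [gf fg]]].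
  have finj : lker (linfun (cmp f : mhom U V -> mhom U W)) == 0%VS.
    apply/lker0P => x y; rewrite !lfunE /= => fxy.
    by rewrite -[x]cmp1m -[y]cmp1m -gf -!cmpA fxy.
  by rewrite /hdim -(limg_dim_eq (f := linfun (cmp f : mhom U V -> mhom U W)))
     ?dimvS ?subvf // (eqP finj) capv0.
by move=> XY; apply/eqP; rewrite eqn_leq !half //; exact: isomorphic_sym.
Qed.

End LinearCategory.

(** * Last morphisms of chains and of ladders between chains *)

Section Chains.
Variables (k : fieldType) (C : linCat k).
Implicit Types A B D X Y Z W U : C.

(** Unlike [arr c m], this keeps the target [Z] visible in the type. *)
Fixpoint chain_last m A Z : chain m A Z -> {W : C & mhom W Z} :=
  if m isn't m'.+1 then fun f : mhom A Z => existT _ A f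
  else fun c => chain_last (projT2 c).2.

Lemma arr_last m A Z (c : chain m A Z) :
  arr c m = Arrow (projT2 (chain_last c)).
Proof. by elim: m A c => [//|m IHm] A c; exact: IHm. Qed.

Lemma chain_last_rcons m A Z Y (c : chain m A Z) (z : mhom Z Y) :
  chain_last (chain_rcons c z) = existT (fun W => mhom W Y) Z z.
Proof. by elim: m A c => [//|m IHm] A c; exact: IHm. Qed.

Lemma arr_rcons m A Z Y (c : chain m A Z) (z : mhom Z Y) i :
  arr (chain_rcons c z) i = if (i <= m)%N then arr c i else Arrow z.
Proof.
elim: m A c i => [|m IHm] A c [|i] //=.
exact: IHm.
Qed.

Lemma commutes_last m A Z B W (c : chain m.+1 A Z) (d : chain m.+1 B W)
    (p : mhom A B) (q : inner c d) (z : mhom Z W) :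
  commutes p q z ->
  exists v : mhom (projT1 (chain_last c)) (projT1 (chain_last d)),
    z ∘ projT2 (chain_last c) = projT2 (chain_last d) ∘ v.
Proof.
elim: m A B c d p q => [|m IHm] A B c d p q [_ qz]; last exact: IHm qz.
by exists q.1.
Qed.

End Chains.

(** * Transfer of properties along the suspension *)

Section Automorphism.
Variables (k : fieldType) (C : linCat k) (S : automorphism C).
Implicit Types A B D X Y Z W U : C.

Lemma amor_inj A B : injective (@amor _ _ S A B).
Proof. exact: bij_inj (amor_bij S A B). Qed.

Lemma amor_surj A B (g : mhom (S A) (S B)) : exists f, amor S f = g.
Proof. by have [h _ hK] := amor_bij S A B; exists (h g). Qed.

Lemma amor0 A B : amor S (0 : mhom A B) = 0.
Proof. by apply: (addrI (amor S 0)); rewrite -amorD !addr0. Qed.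

Lemma isomorphic_amor A B : isomorphic (S A) (S B) -> isomorphic A B.
Proof.
move=> [f [g []]]; have [f' <-] := amor_surj f; have [g' <-] := amor_surj g.
rewrite -!amor_cmp -!amor_id => /amor_inj gf /amor_inj fg.
by exists f', g'.
Qed.

Lemma idempotents_amor A : trivial_idempotents A -> trivial_idempotents (S A).
Proof.
move=> Aid e; have [e' <-] := amor_surj e.
rewrite -amor_cmp => /amor_inj /Aid[->|->]; [left|right].
  exact: amor0.
exact: amor_id.
Qed.

Lemma indecomposable_amor A :
  krull_schmidt C -> indecomposable A -> indecomposable (S A).
Proof.
move=> KS Aind; apply: idempotents_indecomposable.
  move=> /isomorphic_zobP; rewrite -amor_id -(amor0 A A) => /amor_inj A0.
  by case: Aind => + _; apply; apply/isomorphic_zobP.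
exact/idempotents_amor/indecomposable_idempotents.
Qed.

Lemma nonzero_amor A B :
  (exists g : mhom (S A) (S B), g <> 0) -> exists f : mhom A B, f <> 0.
Proof.
move=> [g]; have [f <-] := amor_surj g => f0; exists f => f00.
by apply: f0; rewrite f00 amor0.
Qed.

End Automorphism.

(** * Rotations of sequences *)

Section Angulation.
Variables (k : fieldType) (n : nat) (C : linCat k) (S : automorphism C).
Variable Theta : set (Defs.nseq n S).
Hypothesis ThetaP : angulation Theta.
Implicit Types (A B : Defs.nseq n S) (U V X Y Z : C).

Lemma rotate_angle A : Theta A -> Theta (rotate A).
Proof. by move/(N2 ThetaP). Qed.

Lemma iter_rotate_angle i A : Theta A -> Theta (iter i (@rotate _ _ _ S) A).
Proof. by move=> ?; elim: i => //= i; exact: rotate_angle. Qed.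

Lemma arr_rotate A i :
  arr (body (rotate A)) i =
  if (i <= n)%N then arr (body A) i.+1
  else Arrow ((-1) ^+ n *: amor S (mor0 A)).
Proof. exact: arr_rcons. Qed.

Lemma arr_iter_rotate i j A : (i + j <= n.+1)%N ->
  arr (body (iter i (@rotate _ _ _ S) A)) j = arr (body A) (i + j).
Proof.
elim: i j => [//|i IHi] j ij; rewrite iterS arr_rotate.
rewrite ifT; last by rewrite -ltnS (leq_trans _ ij) // ltnS leq_addl.
by rewrite IHi addnS -?addSn.
Qed.

(** Reduces statements about any morphism of a sequence to statements about a first morphism;
    [Arrow] absorbs the dependence on the end objects. *)
Lemma arrow_iter_rotate i A : (i <= n.+1)%N ->
  arr (body A) i = Arrow (mor0 (iter i (@rotate _ _ _ S) A)).
Proof. by move=> ni; rewrite -[i in LHS]addn0 -arr_iter_rotate ?addn0. Qed.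

Lemma arrow_iter_rotate_last A :
  Arrow (mor0 (iter n.+2 (@rotate _ _ _ S) A)) =
  Arrow ((-1) ^+ n *: amor S (mor0 A)).
Proof. by rewrite iterSr -arrow_iter_rotate // arr_rotate ltnn. Qed.

Lemma cod_last A : cod (arr (body A) n.+1) = S (start A).
Proof. by rewrite arr_last. Qed.

(** The rotated trivial angle ends with [(-1) ^+ n] times the identity of [S U], so the last square
    of the ladder is the claimed factorization. *)
Lemma amor_rotate_triv U A (p : nseq_map (rotate (nseq_triv n S U)) A) :
  is_morphism p ->
  exists v : mhom (S U) (projT1 (chain_last (body A))),
    amor S (map0 p) = (-1) ^+ n *: (projT2 (chain_last (body A)) ∘ v).
Proof.
move=> /commutes_last; have -> := chain_last_rcons
  (tail1 (nseq_triv n S U)) ((-1) ^+ n *: amor S (idm U)).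
move=> -[/= v vE].
exists v; by rewrite -vE cmpZr amor_id cmpm1 scalerA -expr2 sqrr_sign scale1r.
Qed.

End Angulation.

(** * Exactness of Hom(U, -) on angles, and Auslander-Reiten angles *)

Section Exactness.
Variables (k : fieldType) (m : nat).
Local Notation n := m.+1.
Variables (C : linCat k) (S : automorphism C) (Theta : set (Defs.nseq n S)).
Hypothesis ThetaP : angulation Theta.
Implicit Types (A B : Defs.nseq n S) (U V X Y Z : C).
Local Notation rot i A := (iter i (@rotate _ _ _ S) A).

(** Extend the identity and [mor0 A] to a morphism from the trivial angle to [A]: the next square
    starts with a zero morphism into [zob]. *)
Lemma rotate_mor0 A : Theta A -> mor0 (rotate A) ∘ mor0 A = 0.
Proof.
move=> TA; have [] := N3 ThetaP (N1_triv ThetaP (start A)) TA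
  (p0 := idm (start A)) (p1 := mor0 A).
  by [].
move=> p [[_ [sq _]] _ p1]; have -> : mor0 A = (maps p).1 by rewrite -p1.
by move: sq; rewrite /= cmpm0 => ->.
Qed.

(** [b] and 0 extend to a morphism from the rotated trivial angle to [rotate A], whose last morphism
    is [mor0 A] suspended, up to sign; the last square factors [amor S b] through it. *)
Lemma rotate_exact A U (b : mhom U (obj1 A)) :
  Theta A -> mor0 (rotate A) ∘ b = 0 -> exists a, b = mor0 A ∘ a.
Proof.
move=> TA fb; have := N3 ThetaP (rotate_angle ThetaP (N1_triv ThetaP U))
  (rotate_angle ThetaP TA) (p0 := b) (p1 := 0).
rewrite cmp0m fb => -[//|p [/amor_rotate_triv + p0 _]].
rewrite {}p0.
have -> := chain_last_rcons (tail1 A) ((-1) ^+ n *: amor S (mor0 A)).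
move=> -[/= v]; have [a <-] := amor_surj v.
rewrite cmpZl scalerA -expr2 sqrr_sign scale1r -amor_cmp => /amor_inj bE.
by exists a.
Qed.

(** The boundary condition for Hom(U, -): with [V = U] it controls the right end of the complex,
    with [V = S U] the left end. *)
Definition last_kills V A : Prop :=
  forall v : mhom V (nobj A n.+1), nmor A n.+1 ∘ v = 0.

Lemma last_killsE V A : last_kills V A <->
  forall v : mhom V (start (rot n.+1 A)), mor0 (rot n.+1 A) ∘ v = 0.
Proof. by rewrite /last_kills /nmor /nobj arrow_iter_rotate. Qed.

(** As in [rotate_exact], [amor S w] factors through the last morphism of [A] composed with a
    morphism from [S U], which is zero. *)
Lemma mor0_injective A U (w : mhom U (start A)) :
  Theta A -> last_kills (S U) A -> mor0 A ∘ w = 0 -> w = 0.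
Proof.
move=> TA; rewrite /last_kills /nmor /nobj arr_last => kill fw.
have := N3 ThetaP (rotate_angle ThetaP (N1_triv ThetaP U)) TA
  (p0 := w) (p1 := 0).
rewrite cmp0m fw => -[//|p [/amor_rotate_triv + p0 _]].
rewrite {}p0 => -[v]; rewrite kill scaler0 -(amor0 S U (start A)).
exact: amor_inj.
Qed.

Definition mor0_post U A : 'Hom(mhom U (start A), mhom U (obj1 A)) :=
  linfun (cmp (mor0 A)).

Definition kdim U A : nat := \dim (lker (mor0_post U A)).

(** Rank-nullity, the image of one map being the kernel of the next by exactness. *)
Lemma hdim_start U A : Theta A ->
  hdim U (start A) = (kdim U A + kdim U (rotate A))%N.
Proof.
move=> TA; rewrite /hdim -(limg_ker_dim (mor0_post U A)) capfv.
congr (_ + \dim _)%N.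
apply/vspaceP => b; rewrite memv_ker lfunE /=; apply/idP/eqP.
  case/memv_imgP => a _ ->; rewrite lfunE /= cmpA rotate_mor0 //.
  exact: cmp0m.
move=> /(rotate_exact TA)[a ->]; apply/memv_imgP; exists a; first exact: memvf.
by rewrite lfunE.
Qed.

Lemma hdim_nobj U A i : Theta A -> (i < n.+2)%N ->
  hdim U (nobj A i) = (kdim U (rot i A) + kdim U (rot i.+1 A))%N.
Proof.
move=> TA lt_i; rewrite /nobj arrow_iter_rotate //.
by apply: hdim_start; exact: iter_rotate_angle.
Qed.

Lemma kdim_start0 U A : Theta A -> last_kills (S U) A -> kdim U A = 0%N.
Proof.
move=> TA kill; apply/eqP; rewrite dimv_eq0; apply/lker0P => f g.
rewrite !lfunE /= => fg; apply/eqP; rewrite -subr_eq0; apply/eqP.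
by apply: (mor0_injective TA kill); rewrite linearB /= fg subrr.
Qed.

Lemma kdim_last0 U A : Theta A -> last_kills U A -> kdim U (rot n.+2 A) = 0%N.
Proof.
move=> TA /last_killsE kill.
have := hdim_start U (iter_rotate_angle ThetaP n.+1 TA).
suff -> : kdim U (rot n.+1 A) = hdim U (start (rot n.+1 A)).
  by rewrite -[LHS]addn0 => /addnI.
congr (\dim _); apply/vspaceP => v; rewrite memvf memv_ker lfunE; apply/eqP.
exact: kill.
Qed.

(* The Euler characteristic of the complex [Hom(U, A)], whose homology can only
   sit at its two ends, where [last_kills] makes it vanish. *)
Lemma hdim_euler U A : Theta A -> last_kills U A -> last_kills (S U) A ->
  \sum_(i < n.+2) (-1) ^+ i * (hdim U (nobj A i))%:Z = 0.
Proof.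
move=> TA killU killSU.
rewrite -(big_mkord xpredT (fun i => (-1) ^+ i * (hdim U (nobj A i))%:Z)).
(* Each dimension is a sum of two consecutive kernel dimensions, so only the kernels at 0 and [n.+2]
   survive. *)
rewrite (telescope_sumr_eq (m := n.+2)
  (fun i => - ((-1) ^+ i * (kdim U (rot i A))%:Z))) //.
  by rewrite kdim_last0 // kdim_start0 // !mulr0 !oppr0 addr0.
move=> i /andP[_ lt_i]; rewrite hdim_nobj // PoszD mulrDr exprS mulN1r.
by rewrite mulNr !opprK addrC.
Qed.

Lemma AR_last_kills V A : Theta A -> right_almost_split (nmor A n) ->
  trivial_idempotents V -> ~ isomorphic V (nobj A n.+1) -> last_kills V A.
Proof.
move=> TA; rewrite last_killsE /nmor /nobj.
rewrite (arrow_iter_rotate (i := n)) // (arrow_iter_rotate (i := n.+1)) //.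
move=> [nret fact] Vid nV v.
have nZ := right_almost_split_target (conj nret fact).
have [g ->] : exists g, v = mor0 (rot n A) ∘ g.
  by apply: fact => /(retraction_iso Vid nZ).
rewrite cmpA; apply: etrans (cmp0m _ g); congr (_ ∘ g).
by apply: rotate_mor0; exact: iter_rotate_angle.
Qed.

(* The square formed by an isomorphism [start (rotate B) = start (rotate A)] and
   a factorization of [mor0 B] through [mor0 A] extends to a morphism of angles,
   through which [mor0 (rotate A)] factors. *)
Lemma nonzero_mhom_obj1 A B : Theta A -> Theta B ->
  right_almost_split (mor0 A) -> start (rotate B) = start (rotate A) ->
  mor0 (rotate B) <> 0 ->
  exists g : mhom (obj1 (rotate B)) (obj1 (rotate A)), g <> 0.
Proof.
move=> TA TB [nret fact] BA f0.
(* An isomorphism replaces the equality of objects, so that no casts are needed. *)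
have [p [q [qp pq]]] : isomorphic (start (rotate B)) (start (rotate A)).
  by rewrite BA; exact: isomorphic_refl.
have [t tE] : exists t, p ∘ mor0 B = mor0 A ∘ t.
  (* A right inverse of [p ∘ mor0 B] would split [mor0 B], forcing the next morphism of [B] to
     vanish. *)
  apply: fact => -[s sE]; apply: f0; rewrite -[LHS]cmpm1 -qp -[X in q ∘ X]cmp1m.
  by rewrite -sE !cmpA -(cmpA _ q p) qp cmpm1 rotate_mor0 // !cmp0m.
have [p' [[_ [sq _]] _ p'E]] := N3 ThetaP TB TA tE.
(* If this component were zero, so would be [mor0 (rotate A)]; by exactness the identity would then
   factor through [mor0 A]. *)
exists (maps p').2.1 => g0; apply: nret.
have : mor0 (rotate A) ∘ (p : mhom _ (obj1 A)) = 0.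
  by move: sq; rewrite /= g0 cmp0m -/(map1 p') p'E => <-.
move=> fp; have [|s sE] := rotate_exact TA (b := idm (start (rotate A))).
  by rewrite -pq cmpA fp cmp0m.
by exists s; rewrite -sE.
Qed.

(** Rotate [A] by [n] and [B] by [n.+1]: both second objects are then [S (start B)], the next
    morphism of [B] is [mor0 B] suspended up to sign, and the morphism obtained desuspends. *)
Lemma nonzero_mhom_start A B :
  Theta A -> Theta B -> right_almost_split (nmor A n) ->
  nobj A n.+1 = S (start B) -> mor0 B <> 0 ->
  exists g : mhom (obj1 B) (start A), g <> 0.
Proof.
move=> TA TB; rewrite /nmor /nobj.
rewrite (arrow_iter_rotate (i := n)) // (arrow_iter_rotate (i := n.+1)) //.
move=> ras /= XE f0.
apply: (nonzero_amor (S := S)); rewrite -cod_last arrow_iter_rotate //.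
have lastB := arrow_iter_rotate_last B.
have -> : S (obj1 B) = obj1 (rot n.+2 B).
  by rewrite -[RHS]/(cod (Arrow (mor0 (rot n.+2 B)))) lastB.
apply: (nonzero_mhom_obj1 (A := rot n A) (B := rot n.+1 B)) => //.
- exact: iter_rotate_angle.
- exact: iter_rotate_angle.
- by rewrite -[LHS]/(Defs.dom (Arrow (mor0 (rot n.+2 B)))) lastB.
(* Generalizing over the arrow lets [lastB] be used despite the dependent types. *)
- have nz a : a = Arrow ((-1) ^+ n *: amor S (mor0 B)) -> mor a <> 0.
    move=> -> /eqP; rewrite scaler_eq0 signr_eq0 /= -(amor0 S) => /eqP.
    by move/amor_inj.
  exact: nz lastB.
Qed.

End Exactness.

(** * Euler characteristics on Grothendieck groups *)

Lemma subgroup_gen_sub (G : zmodType) (T : set G) : T `<=` subgroup_gen T.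
Proof. by move=> x Tx H _; apply. Qed.

Lemma subgroup_gen_zmod_morphism0 (G H : zmodType) (f : {additive G -> H})
    (T : set G) x :
  (forall y, T y -> f y = 0) -> subgroup_gen T x -> f x = 0.
Proof.
move=> fT Tx; apply: (Tx [set y | f y = 0]) => //; split; first exact: raddf0.
by move=> y z /=; rewrite raddfB => -> ->; rewrite subrr.
Qed.

Section GrothendieckGroup.
Variables (k : fieldType) (m : nat).
Local Notation n := m.+1.
Variable C : angCat k n.
Local Notation S := (susp C).
Implicit Types (A B : Defs.nseq n S) (U V X Y Z : C).

Definition euler U : Fgrp C -> int :=
  fglift (fun c : isoclass C => (hdim U (repr c))%:Z : int^o).

HB.instance Definition _ U := GRing.isZmodMorphism.Build (Fgrp C) int
  (euler U) (@lift_is_additive int (isoclass C) int^o _).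

Lemma eulerU U (a : int) X : euler U << a *g cls X >> = a * (hdim U X)%:Z.
Proof.
rewrite /euler liftU; congr (_ * Posz _); apply: isomorphic_hdim.
exact/clsP/cls_repr.
Qed.

Lemma euler_chi0 U A : angle C A -> last_kills U A -> last_kills (S U) A ->
  euler U (chi A) = 0.
Proof.
move=> TA kU kSU; rewrite raddf_sum /=.
under eq_bigr => i _ do rewrite eulerU.
by have h := hdim_euler (angleP C) TA kU kSU; exact: h.
Qed.

Lemma euler_split0 U (x : Fgrp C) :
  subgroup_gen (@split_rels _ _ C) x -> euler U x = 0.
Proof.
apply: (subgroup_gen_zmod_morphism0 (f := euler U)) => _ [A [TA A0] <-].
by apply: euler_chi0 => // v; rewrite A0 cmp0m.
Qed.

Lemma euler_AR0 U A : trivial_idempotents U -> AR_angle A ->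
  ~ isomorphic U (nobj A n.+1) -> ~ isomorphic (S U) (nobj A n.+1) ->
  euler U (chi A) = 0.
Proof.
move=> Uid [TA _ ras _] nU nSU.
apply: euler_chi0 => //; apply: (AR_last_kills (angleP C)) => //.
exact: idempotents_amor.
Qed.

Lemma K0_split_class_inj (x y : Fgrp C) :
  K0_split_class x = K0_split_class y ->
  subgroup_gen (@split_rels _ _ C) (x - y).
Proof. by move=> /eqP; rewrite -Quotient.idealrBE => /asboolP. Qed.

Lemma K0_split_classB (x y : Fgrp C) :
  K0_split_class (x - y) = K0_split_class x - K0_split_class y.
Proof. exact: raddfB. Qed.

Lemma K0_class0 (x : Fgrp C) : subgroup_gen (@rels _ _ C) x -> K0_class x = 0.
Proof.
move=> xR; apply: etrans (raddf0 (\pi_(Quotient.quot _))%qT); apply/eqP.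
by rewrite -Quotient.idealrBE subr0; apply/asboolP.
Qed.

(** Phrased with a representative in the free group, where [euler] lives; by [euler_split0] its
    values do not depend on the representative. *)
Definition finite_euler_support (x : K0_split C) : Prop :=
  exists (F : set (isoclass C)) (y : Fgrp C),
    [/\ finite_set F, K0_split_class y = x &
        forall U, indecomposable U -> ~ F (cls U) -> euler U y = 0].

Lemma AR_span_euler0 (x : K0_split C) : krull_schmidt C ->
  subgroup_gen [set K0_split_class (chi A) | A in @AR_angle k n C] x ->
  finite_euler_support x.
Proof.
move=> KS xAR; apply: (xAR finite_euler_support); first split.
- by exists set0, 0; split=> // [|U _ _]; exact: raddf0.
- move=> _ _ [F [y [Ffin <- yP]]] [F' [y' [F'fin <- y'P]]].
  exists (F `|` F'), (y - y'); rewrite finite_setU K0_split_classB.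
  split=> // U Uind FU; rewrite raddfB /= yP ?y'P ?subrr //.
    by move=> Fy'; apply: FU; right.
  by move=> Fy; apply: FU; left.
move=> _ [A ARA <-].
(* The two exceptions are [U] isomorphic to the end term, and [S U] isomorphic to it. *)
exists [set cls (nobj A n.+1); cls (aobjV S (nobj A n.+1))], (chi A).
split=> // U Uind FU.
apply: euler_AR0 ARA _ _; first exact: indecomposable_idempotents.
  by move=> UA; apply: FU; left; apply/clsP.
move=> SUA; apply: FU; right; apply/clsP; apply: (isomorphic_amor (S := S)).
by rewrite aobjVK.
Qed.

(** Rotation shifts each shared term by one place, reversing its sign; the first term of [A] and the
    last of [rotate A] remain, the latter with sign -1 because [n] is even. *)
Lemma chi_rotate A : ~~ odd n ->
  chi A + chi (rotate A) = << cls (start A) >> - << cls (S (start A)) >>.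
Proof.
move=> n_even; rewrite /chi big_ord_recl [X in _ + X]big_ord_recr /=.
rewrite addrACA [X in _ + X]addrC addrACA -big_split /=.
rewrite [X in _ + X]big1 => [|i _].
  rewrite addr0 -[in (-1) ^+ m.+2]signr_odd /= n_even expr1 freegUN /nobj.
  by rewrite arr_rotate ltnn.
by rewrite /nobj arr_rotate -ltnS ltn_ord freegUD exprS mulN1r subrr freegU0.
Qed.

Lemma rels_iter_aobjV X j : ~~ odd n ->
  subgroup_gen (@rels _ _ C) (<< cls X >> - << cls (iter j (aobjV S) X) >>).
Proof.
move=> n_even; have [R0 RB] := subgroup_gen_is_subgroup (@rels _ _ C).
elim: j => [|j IHj]; first by rewrite subrr.
(* Adding [chi] of this trivial angle and of its rotation relates [Y] to its desuspension. *)
set Y := iter j _ X in IHj *; pose A := nseq_triv n S (aobjV S Y).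
have TA : angle C A := N1_triv (angleP C) (aobjV S Y).
have chiR B : angle C B -> subgroup_gen (@rels _ _ C) (chi B).
  by move=> TB; apply: subgroup_gen_sub; exists B.
have : subgroup_gen (@rels _ _ C) (chi A + chi (rotate A)).
  rewrite -[chi (rotate A)]opprK -[- chi (rotate A)]sub0r.
  apply: (RB _ _ (chiR _ TA)); apply: (RB _ _ R0).
  by apply: chiR; exact: (rotate_angle (angleP C)).
rewrite chi_rotate //= aobjVK => /(RB _ _ IHj).
by rewrite opprB addrA addrNK.
Qed.

Hypothesis C_KS : krull_schmidt C.

(** The difference [z] of the two classes has the same split class as some [y] with finite Euler
    support; outside that support the two dimensions would agree, against the hypothesis. *)
Lemma finite_predecessors X j :
  [set x : K0_split C | K0_pi x = 0] =
    subgroup_gen [set K0_split_class (chi A) | A in @AR_angle k n C] ->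
  (forall U, indecomposable U -> (exists f : mhom U X, f <> 0) ->
     hdim U (iter j (aobjV S) X) <> hdim U X) ->
  ~~ odd n ->
  finite_set [set cls U | U in
    [set U | indecomposable U /\ exists f : mhom U X, f <> 0]].
Proof.
move=> h2 h1 n_even.
pose z : Fgrp C := << cls X >> - << cls (iter j (aobjV S) X) >>.
have : [set x : K0_split C | K0_pi x = 0] (K0_split_class z).
  by rewrite /mkset K0_piE; apply: K0_class0; exact: rels_iter_aobjV.
rewrite h2 => /(AR_span_euler0 C_KS)[F [y [Ffin yz yP]]].
apply: sub_finite_set Ffin => _ [U [Uind UX] <-].
apply: contrapT => FU; apply: (h1 U Uind UX).
have /(euler_split0 U) := K0_split_class_inj yz.
rewrite raddfB /= yP // sub0r /z raddfB /= !eulerU !mul1r => /eqP.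
by rewrite oppr_eq0 subr_eq0 eq_sym => /eqP [].
Qed.

Lemma successor_predecessor X : has_AR_angles C -> indecomposable X ->
  exists2 Z, indecomposable Z &
    forall Y, (exists f : mhom X Y, f <> 0) -> exists f : mhom Y Z, f <> 0.
Proof.
move=> C_AR Xind; have [_ [A [[TA las ras _] AE]]] :=
  C_AR _ (indecomposable_amor S C_KS Xind).
exists (nobj A 0); first exact: left_almost_split_indecomposable las.
(* Completing [f] to an angle gives the second input of [nonzero_mhom_start]. *)
move=> Y [f f0]; have [c Tc] := N1_mor (angleP C) f.
exact: (nonzero_mhom_start (angleP C) (B := NSeq (chain_cons f c))).
Qed.

End GrothendieckGroup.

(** * Finiteness of predecessors and of successors *)

Theorem theorem1p4 (k : closedFieldType) (n : nat) (n_gt0 : (0 < n)%N)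
    (n_even : ~~ odd n) (C : angCat k n) (C_KS : krull_schmidt C)
    (C_AR : has_AR_angles C)
    (h1 : forall X : C, indecomposable X ->
       exists m : nat, (0 < m)%N /\
         forall U : C, indecomposable U -> (exists f : mhom U X, f <> 0) ->
           \dim {: mhom U (iter m (aobjV (susp C)) X)} <> \dim {: mhom U X})
    (h2 : [set x : K0_split C | K0_pi x = 0] =
          subgroup_gen [set K0_split_class (chi A) | A in @AR_angle k n C]) :
  locally_finite C.
Proof.
case: n n_gt0 n_even C C_KS C_AR h1 h2 => [//|m] _ n_even C KS AR h1 h2.
have pred_finite (X : C) : indecomposable X -> finite_set [set cls U | U in
    [set U | indecomposable U /\ exists f : mhom U X, f <> 0]].
  by move=> /h1[j [_ hj]]; exact: (finite_predecessors KS h2 hj n_even).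
move=> X Xind; split; last exact: pred_finite.
(* All successors of [X] are predecessors of this single [Z]. *)
have [Z Zind XZ] := successor_predecessor KS AR Xind.
apply: sub_finite_set (pred_finite Z Zind) => _ [Y [Yind XY] <-].
by exists Y => //; split=> //; exact: XZ.
Qed.
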